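(* Let $$t(x,y)=\sum_{n=0}^{\infty}\frac{(x)_n\,(x)_{n+1}}{(x+y)_n\,(x+y)_{n+1}}(-1)^n.$$ Then, for $x$ and $y$ such that both sides converge, $$t(x,y)=\sum_{j=0}^{\infty}\left(-\tfrac14\right)^{j}\frac{x\,y^2(y+1)(y+2)\left(6x(2j+y)+5(2j+y)^2+4(2j+y)+2x^2+2x\right)}{4(x+y)^2(x+y+1)^2(2j+x+y)^2(2j+x+y+1)}\cdot\left[\begin{matrix}\frac{y}{2}+1,\ \frac{y}{2}+1,\ \frac{y}{2}+2,\ \frac{y+3}{2}\\ \frac{x+y}{2}+1,\ \frac{x+y}{2}+1,\ \frac{x+y+3}{2},\ \frac{x+y+3}{2}\end{matrix}\right]_{j-1}.$$
   Context: $(a)_n=\Gamma(a+n)/\Gamma(a)$ is the Pochhammer symbol (so $(a)_n=a(a+1)\cdots(a+n-1)$ for $n\ge 0$ and $(a)_{-1}=1/(a-1)$). The bracket notation denotes a quotient of Pochhammer symbols: $\left[\begin{matrix}\alpha_1,\dots,\alpha_p\\ \beta_1,\dots,\beta_q\end{matrix}\right]_n=\frac{(\alpha_1)_n\cdots(\alpha_p)_n}{(\beta_1)_n\cdots(\beta_q)_n}$. *)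

(* Defs.v *)
From Stdlib Require Import Reals ZArith List Lra Lia.
From Coquelicot Require Import Coquelicot.
Import ListNotations.

Open Scope C_scope.

Fixpoint rising (a : C) (n : nat) : C :=
  match n with
  | O => 1
  | S k => rising a k * (a + INR k)
  end.

(* [poch a n] is Gamma(a+n)/Gamma(a) for an integer n: the product
   a(a+1)...(a+n-1) when n >= 0, and (a)_{-k} = 1/((a-k)(a-k+1)...(a-1)).
   In particular [poch a n] is meaningful for n >= 0 also when a is a pole of
   Gamma, where it is the product. *)
Definition poch (a : C) (n : Z) : C :=
  if (0 <=? n)%Z then rising a (Z.to_nat n)
  else / rising (a + IZR n) (Z.to_nat (- n)).

Definition poch_prod (l : list C) (n : Z) : C :=
  fold_right (fun a r => poch a n * r) 1 l.

Definition poch_bracket (num den : list C) (n : Z) : C :=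
  poch_prod num n / poch_prod den n.

(* Componentwise sum of a complex series; meaningful only when the series
   converges in C, see [CSeries_unique]. *)
Definition CSeries (a : nat -> C) : C :=
  (Series (fun n => Re (a n)), Series (fun n => Im (a n))).

Definition t_term (x y : C) (n : nat) : C :=
  (poch x (Z.of_nat n) * poch x (Z.of_nat n + 1))
  / (poch (x + y) (Z.of_nat n) * poch (x + y) (Z.of_nat n + 1))
  * (- (1)) ^ n.

Definition t (x y : C) : C := CSeries (t_term x y).

(* At j = 0 the bracket has index -1 and its numerator is
   1/((y/2)^2 (y/2+1) ((y+1)/2)), so the formula is literally defined only for
   y not in {0,-1,-2}.  For these y, if no (x+y)_n vanishes, the terms of
   t(x,y) do not tend to 0, so the value of the total inverse at 0 plays no
   role where t(x,y) converges. *)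
Definition accel_term (x y : C) (j : nat) : C :=
  let J := RtoC (INR j) in
  (- (1 / 4)) ^ j
  * ((x * y ^ 2 * (y + 1) * (y + 2)
      * (6 * x * (2 * J + y) + 5 * (2 * J + y) ^ 2 + 4 * (2 * J + y)
         + 2 * x ^ 2 + 2 * x))
     / (4 * (x + y) ^ 2 * (x + y + 1) ^ 2
        * (2 * J + x + y) ^ 2 * (2 * J + x + y + 1)))
  * poch_bracket
      [y / 2 + 1; y / 2 + 1; y / 2 + 2; (y + 3) / 2]
      [(x + y) / 2 + 1; (x + y) / 2 + 1; (x + y + 3) / 2; (x + y + 3) / 2]
      (Z.of_nat j - 1).

Lemma rising_shift (a : C) (n : nat) :
  rising a (S n) = a * rising (a + 1) n.
Proof.
induction n as [|n IH].
- simpl; ring.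
- change (rising a (S n) * (a + INR (S n)) = a * (rising (a + 1) n * (a + 1 + INR n))).
  rewrite IH, S_INR, RtoC_plus; ring.
Qed.

Lemma poch_0 (a : C) : poch a 0 = 1.
Proof. reflexivity. Qed.

(* The functional equation that, with [poch_0], characterises
   Gamma(a+n)/Gamma(a) on the integers n. *)
Lemma poch_succ (a : C) (n : Z) :
  a + IZR n <> 0 -> poch a (n + 1) = (a + IZR n) * poch a n.
Proof.
intros Hn; unfold poch.
destruct (Z.leb_spec 0 n) as [H|H].
- rewrite (proj2 (Z.leb_le 0 (n + 1))) by lia.
  replace (Z.to_nat (n + 1)) with (S (Z.to_nat n)) by lia.
  simpl rising; rewrite INR_IZR_INZ, Z2Nat.id by lia; ring.
- replace (Z.to_nat (- n)) with (S (Z.to_nat (- (n + 1)))) by lia.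
  rewrite rising_shift.
  replace (a + IZR n + 1) with (a + IZR (n + 1))
    by (rewrite plus_IZR, RtoC_plus; ring).
  assert (E : forall u v : C, u <> 0 -> u * / (u * v) = / v).
  { intros u v Hu. destruct (Ceq_dec v 0) as [->|Hv].
    - rewrite Cmult_0_r; unfold Cinv; simpl.
      apply injective_projections; simpl; unfold Rdiv; ring.
    - field; split; assumption. }
  rewrite E by exact Hn.
  destruct (Z.leb_spec 0 (n + 1)) as [H1|H1].
  + replace (n + 1)%Z with 0%Z by lia; simpl; field; intro K; injection K; lra.
  + reflexivity.
Qed.

Lemma poch_m1 (a : C) : poch a (-1) = 1 / (a - 1).
Proof.
unfold poch; simpl.
replace (1 * (a + RtoC (-1) + RtoC 0)) with (a - 1).
- unfold Cdiv; ring.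
- apply injective_projections; simpl; ring.
Qed.

Lemma CSeries_unique (a : nat -> C) (l : C) : is_series a l -> CSeries a = l.
Proof.
intros H; destruct l as [u v]; unfold CSeries; f_equal.
- apply is_series_unique.
  apply (filterlim_ext (fun n => Re (sum_n a n))).
  + intro n; induction n as [|n IH]; [now rewrite !sum_O|].
    now rewrite !sum_Sn, <- IH.
  + eapply filterlim_comp; [exact H|].
    intros P [e He]; exists e; intros z Hz; apply He, Hz.
- apply is_series_unique.
  apply (filterlim_ext (fun n => Im (sum_n a n))).
  + intro n; induction n as [|n IH]; [now rewrite !sum_O|].
    now rewrite !sum_Sn, <- IH.
  + eapply filterlim_comp; [exact H|].
    intros P [e He]; exists e; intros z Hz; apply He, Hz.
Qed.

(* Main.v *)
(* With [F_n(y)] the summand of [t(x,y)], the Wilf-Zeilberger method yields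
   [F_n(y) - B(y) F_n(y+2) = r(x+n) F_n(y) - r(x+n+1) F_{n+1}(y)] for rational
   functions [B] and [r], with [r(x+n)] bounded as [n] grows.  Since [F_n(y)]
   tends to 0, summing gives [t(x,y) = r(x) F_0(y) + B(y) t(x,y+2)].  Iterating,
   the remainder after [N] steps is [B(y) B(y+2) ... B(y+2N-2) t(x,y+2N)]:
   [B] tends to [-1/4] and [t(x,y+2N)] stays bounded, so it vanishes in the
   limit.  The degenerate case where [y] is a nonpositive integer (some [B] is
   0) is incompatible with the convergence of [t(x,y)]. *)

Require Import Defs.
From Stdlib Require Import Reals ZArith Lra Lia.
From Coquelicot Require Import Coquelicot.

Open Scope C_scope.

(** * Side conditions of [field], and limits of complex series *)

Ltac solve_neq_0 :=
  repeat match goal with |- _ /\ _ => split end; cbv beta; intros E;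
  first [ match goal with
          | H : _ <> RtoC 0 |- _ => apply H; etransitivity; [|exact E]; ring
          | H : RtoC _ = RtoC _ |- _ => apply RtoC_inj in H; lra
          end ].

Lemma RtoC_INR_S (n : nat) : RtoC (INR (S n)) = INR n + 1.
Proof. now rewrite S_INR, RtoC_plus. Qed.

(** Reduces convergence in [C] to a limit of real moduli, so that every limit argument below is a
    real squeeze against [is_lim_seq_0_le]. *)
Lemma is_series_Cmod (a : nat -> C) (l : C) :
  is_series a l <-> is_lim_seq (fun n => Cmod (sum_n a n - l)) 0.
Proof.
split; intros H.
- apply is_lim_seq_spec; intros eps.
  generalize (proj1 (filterlim_locally_ball_norm _ _) H eps).
  apply filter_imp; intros n Hn.
  rewrite Rminus_0_r, Rabs_pos_eq by apply Cmod_ge_0; exact Hn.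
- apply (proj2 (filterlim_locally_ball_norm _ _)); intros eps.
  generalize (proj2 (is_lim_seq_spec _ _) H eps).
  apply filter_imp; intros n Hn.
  rewrite Rminus_0_r, Rabs_pos_eq in Hn by apply Cmod_ge_0; exact Hn.
Qed.

Lemma is_lim_seq_0_le (u v : nat -> R) :
  eventually (fun n => (0 <= u n <= v n)%R) -> is_lim_seq v 0 -> is_lim_seq u 0.
Proof.
intros H Hv; apply (is_lim_seq_le_le_loc (fun _ => 0%R) u v); trivial.
apply is_lim_seq_const.
Qed.

Lemma ex_series_Cmod_lim (a : nat -> C) :
  @ex_series C_AbsRing C_NormedModule a -> is_lim_seq (fun n => Cmod (a n)) 0.
Proof.
intros [l Hl]; apply is_series_Cmod in Hl.
apply is_lim_seq_incr_1.
apply (is_lim_seq_0_le _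
  (fun n => (Cmod (sum_n a (S n) - l) + Cmod (sum_n a n - l))%R)).
- exists 0%nat; intros n _; split; [apply Cmod_ge_0|].
  replace (a (S n)) with ((sum_n a (S n) - l) + - (sum_n a n - l)).
  + eapply Rle_trans; [apply Cmod_triangle|]; rewrite Cmod_opp; apply Rle_refl.
  + rewrite sum_Sn; change plus with Cplus; ring.
- replace (Finite 0) with (Finite (0 + 0)) by (f_equal; ring).
  apply is_lim_seq_plus'; [|exact Hl].
  apply (is_lim_seq_incr_1 (fun n => Cmod (sum_n a n - l))); exact Hl.
Qed.

(** * Pochhammer symbols and the summand of [t] *)

Lemma poch_of_nat (a : C) (n : nat) : poch a (Z.of_nat n) = rising a n.
Proof.
unfold poch; rewrite (proj2 (Z.leb_le _ _)), Nat2Z.id by lia; reflexivity.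
Qed.

Lemma rising_neq_0 (a : C) (n : nat) :
  (forall k : nat, a + INR k <> 0) -> rising a n <> 0.
Proof.
intros H; induction n as [|n IH]; simpl.
- intros E; injection E; lra.
- now apply Cmult_neq_0.
Qed.

(** Removes the index [j - 1] from the bracket in [accel_term]. The case [n = 0] is included: both
    sides are then [1 / a]. *)
Lemma poch_pred (a : C) (n : nat) :
  a <> 0 -> poch (a + 1) (Z.of_nat n - 1) = rising a n / a.
Proof.
intros Ha; destruct n as [|n].
- simpl Z.sub; rewrite poch_m1; simpl; f_equal; f_equal; ring.
- replace (Z.of_nat (S n) - 1)%Z with (Z.of_nat n) by lia.
  rewrite poch_of_nat, rising_shift; field; exact Ha.
Qed.

Lemma t_term_0 (x y : C) : x + y <> 0 -> t_term x y 0 = x / (x + y).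
Proof.
intros H; unfold t_term, poch; simpl.
replace (x + 0) with x by ring; replace (x + y + 0) with (x + y) by ring.
field; exact H.
Qed.

Lemma t_term_succ (x y : C) (n : nat) :
  (forall k : nat, x + y + INR k <> 0) ->
  t_term x y (S n) =
  - ((x + INR n) * (x + INR n + 1)
     / ((x + y + INR n) * (x + y + INR n + 1))) * t_term x y n.
Proof.
intros H; unfold t_term.
replace (Z.of_nat (S n) + 1)%Z with (Z.of_nat (S (S n))) by lia.
replace (Z.of_nat n + 1)%Z with (Z.of_nat (S n)) by lia.
rewrite !poch_of_nat.
change (rising ?a (S (S n))) with (rising a (S n) * (a + INR (S n))).
change (rising ?a (S n)) with (rising a n * (a + INR n)).
change ((- (1)) ^ S n) with (- (1) * (- (1)) ^ n).
pose proof (rising_neq_0 _ n H) as H0.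
pose proof (H n) as H1; pose proof (H (S n)) as H2.
rewrite RtoC_INR_S in *.
field; solve_neq_0.
Qed.

(** * The Wilf-Zeilberger relation between [y] and [y + 2] *)

Definition step_ratio (x y : C) : C :=
  - (1 / 4) * (y ^ 2 * (y + 1) * (y + 2) / ((x + y) ^ 2 * (x + y + 1) ^ 2)).

(* The Wilf-Zeilberger certificate; it depends on [x] and [n] only through
   [u = x + n]. *)
Definition cert (y u : C) : C :=
  (6 * u * y + 5 * y ^ 2 + 4 * y + 2 * u ^ 2 + 2 * u)
  / (4 * (u + y) * (u + y + 1)).

Lemma shift_poles (x y : C) :
  (forall k : nat, x + y + INR k <> 0) ->
  forall k : nat, x + (y + 2) + INR k <> 0.
Proof.
intros H k E; apply (H (S (S k))); rewrite !RtoC_INR_S, <- E; ring.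
Qed.

(** With [s = x + y], this is [s (s+1) (s+2)_n = (s)_n (s+n) (s+n+1)], used at [n] and at [n + 1],
    in denominator-free form. The induction uses only the term ratio. *)
Lemma t_term_shift (x y : C) (n : nat) :
  (forall k : nat, x + y + INR k <> 0) ->
  t_term x (y + 2) n * ((x + y + INR n) * (x + y + INR n + 1) ^ 2
                        * (x + y + INR n + 2))
  = t_term x y n * ((x + y) ^ 2 * (x + y + 1) ^ 2).
Proof.
intros H; assert (H' := shift_poles x y H).
induction n as [|n IH].
- pose proof (H 0%nat) as H0; pose proof (H 2%nat) as H2.
  rewrite !RtoC_INR_S in H2; simpl in *.
  rewrite !t_term_0.
  + field; solve_neq_0.
  + solve_neq_0.
  + solve_neq_0.
- pose proof (H n) as H0; pose proof (H (S n)) as H1.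
  pose proof (H (S (S n))) as H2; pose proof (H (S (S (S n)))) as H3.
  rewrite !t_term_succ by assumption; rewrite !RtoC_INR_S in *.
  (* Inverting the induction hypothesis leaves a single unknown term, so the goal becomes an
     identity of rational functions. *)
  replace (t_term x y n) with
    (t_term x (y + 2) n * ((x + y + INR n) * (x + y + INR n + 1) ^ 2
                        * (x + y + INR n + 2)) / ((x + y) ^ 2 * (x + y + 1) ^ 2)).
  + pose proof (H 0%nat) as H4; pose proof (H 1%nat) as H5.
    rewrite RtoC_INR_S in H5; simpl in H4, H5.
    field; solve_neq_0.
  + rewrite IH.
    pose proof (H 0%nat) as H4; pose proof (H 1%nat) as H5.
    rewrite RtoC_INR_S in H5; simpl in H4, H5.
    field; solve_neq_0.
Qed.

(** All four terms are rational multiples of [t_term x y n]; after dividing by it, only a rational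
    identity in [x], [y], [n] remains. *)
Lemma t_term_telescope (x y : C) (n : nat) :
  (forall k : nat, x + y + INR k <> 0) ->
  t_term x y n - step_ratio x y * t_term x (y + 2) n
  = cert y (x + INR n) * t_term x y n
    - cert y (x + INR (S n)) * t_term x y (S n).
Proof.
intros H; pose proof (t_term_shift x y n H) as Hs.
pose proof (H n) as H0; pose proof (H (S n)) as H1.
pose proof (H (S (S n))) as H2.
pose proof (H 0%nat) as H4; pose proof (H 1%nat) as H5.
rewrite t_term_succ by exact H; unfold cert, step_ratio.
rewrite !RtoC_INR_S in *; simpl INR in *.
replace (t_term x (y + 2) n) with
  (t_term x y n * ((x + y) ^ 2 * (x + y + 1) ^ 2)
   / ((x + y + INR n) * (x + y + INR n + 1) ^ 2 * (x + y + INR n + 2))).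
- field; solve_neq_0.
- rewrite <- Hs.
  field; solve_neq_0.
Qed.

(** * Vanishing of the boundary term, and summation of the relation *)

Lemma eventually_Re_ge (z : C) (K : R) :
  eventually (fun n => (K <= Re z + INR n)%R).
Proof.
destruct (INR_unbounded (K - Re z)) as [N HN].
exists N; intros n Hn; apply le_INR in Hn; lra.
Qed.

Lemma Re_le_Cmod (z : C) : (Re z <= Cmod z)%R.
Proof. eapply Rle_trans; [apply Rle_abs|apply re_le_Cmod]. Qed.

Lemma Re_add_INR (z : C) (n : nat) : Re (z + INR n) = (Re z + INR n)%R.
Proof. reflexivity. Qed.

Lemma Cmod_div_le (z w : C) : (1 <= Cmod w)%R -> (Cmod (z / w) <= Cmod z)%R.
Proof.
intros H; rewrite Cmod_div by (apply Cmod_gt_0; lra).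
apply Rle_div_l; [lra|].
pose proof (Cmod_ge_0 z); nra.
Qed.

(** The bound is free of [u = x + n], so the boundary term vanishes as soon as the summand does. *)
Lemma cert_bound (y u : C) :
  (1 <= Cmod (u + y))%R -> (1 <= Cmod (u + y + 1))%R ->
  (Cmod (cert y u) <= 1 + Cmod y + Cmod y ^ 2)%R.
Proof.
intros H1 H2.
assert (N1 : u + y <> 0) by (apply Cmod_gt_0; lra).
assert (N2 : u + y + 1 <> 0) by (apply Cmod_gt_0; lra).
(* In this form each quotient has modulus at most [Cmod y], as both denominators have modulus at
   least 1. *)
replace (cert y u) with
  (RtoC (1 / 2) + RtoC (1 / 2) * (y / (u + y))
   + RtoC (1 / 4) * (y / (u + y) * (y / (u + y + 1)))).
2:{ unfold cert; rewrite !RtoC_div by lra; field; solve_neq_0. }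
eapply Rle_trans; [apply Cmod_triangle|].
eapply Rle_trans; [apply Rplus_le_compat_r, Cmod_triangle|].
rewrite !Cmod_mult, !Cmod_R, !Rabs_pos_eq by lra.
pose proof (Cmod_div_le y _ H1); pose proof (Cmod_div_le y _ H2).
pose proof (Cmod_ge_0 (y / (u + y))); pose proof (Cmod_ge_0 (y / (u + y + 1))).
nra.
Qed.

Lemma cert_term_lim (x y : C) :
  is_lim_seq (fun n => Cmod (t_term x y n)) 0 ->
  is_lim_seq (fun n => Cmod (cert y (x + INR n) * t_term x y n)) 0.
Proof.
intros H.
apply (is_lim_seq_0_le _
  (fun n => (1 + Cmod y + Cmod y ^ 2) * Cmod (t_term x y n))%R).
- generalize (eventually_Re_ge (x + y) 1); apply filter_imp; intros n Hn.
  rewrite Cmod_mult; split; [apply Rmult_le_pos; apply Cmod_ge_0|].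
  apply Rmult_le_compat_r; [apply Cmod_ge_0|].
  apply cert_bound; (eapply Rle_trans; [|apply Re_le_Cmod]);
    simpl in *; lra.
- replace (Finite 0) with (Rbar_mult (1 + Cmod y + Cmod y ^ 2)%R 0)
    by (simpl; f_equal; ring).
  apply is_lim_seq_scal_l, H.
Qed.

Lemma sum_t_term_telescope (x y : C) (n : nat) :
  (forall k : nat, x + y + INR k <> 0) ->
  step_ratio x y * sum_n (t_term x (y + 2)) n
  = sum_n (t_term x y) n - cert y x * t_term x y 0
    + cert y (x + INR (S n)) * t_term x y (S n).
Proof.
intros H; induction n as [|n IH].
- rewrite !sum_O; pose proof (t_term_telescope x y 0 H) as E.
  replace (x + INR 0) with x in E by (simpl; ring).
  replace (step_ratio x y * t_term x (y + 2) 0) with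
    (t_term x y 0 - (t_term x y 0 - step_ratio x y * t_term x (y + 2) 0)) by ring.
  rewrite E; ring.
- rewrite !sum_Sn; change plus with Cplus; rewrite Cmult_plus_distr_l, IH.
  pose proof (t_term_telescope x y (S n) H) as E.
  replace (step_ratio x y * t_term x (y + 2) (S n)) with
    (t_term x y (S n) - (t_term x y (S n) - step_ratio x y * t_term x (y + 2) (S n)))
    by ring.
  rewrite E; ring.
Qed.

(** Convergence passes from [y] to [y + 2]: in the telescoped partial sums the boundary term tends
    to 0, and a nonzero [step_ratio] can be divided out. *)
Lemma is_series_t_term_shift (x y l : C) :
  (forall k : nat, x + y + INR k <> 0) -> step_ratio x y <> 0 ->
  is_series (t_term x y) l ->
  is_series (t_term x (y + 2)) ((l - cert y x * t_term x y 0) / step_ratio x y).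
Proof.
intros H HB Hl; apply is_series_Cmod.
assert (Ht : is_lim_seq (fun n => Cmod (t_term x y n)) 0)
  by (apply ex_series_Cmod_lim; exists l; exact Hl).
apply cert_term_lim, is_lim_seq_incr_1 in Ht; apply is_series_Cmod in Hl.
apply (is_lim_seq_0_le _ (fun n => / Cmod (step_ratio x y) *
  (Cmod (sum_n (t_term x y) n - l)
   + Cmod (cert y (x + INR (S n)) * t_term x y (S n))))%R).
- exists 0%nat; intros n _; split; [apply Cmod_ge_0|].
  replace (sum_n (t_term x (y + 2)) n
           - (l - cert y x * t_term x y 0) / step_ratio x y)
    with (/ step_ratio x y *
          (sum_n (t_term x y) n - l
           + cert y (x + INR (S n)) * t_term x y (S n))).
  + rewrite Cmod_mult, Cmod_inv by exact HB.
    apply Rmult_le_compat_l; [|apply Cmod_triangle].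
    apply Rlt_le, Rinv_0_lt_compat, Cmod_gt_0, HB.
  + replace (sum_n (t_term x (y + 2)) n)
      with (step_ratio x y * sum_n (t_term x (y + 2)) n / step_ratio x y)
      by (field; exact HB).
    rewrite sum_t_term_telescope by exact H.
    field; exact HB.
- replace (Finite 0) with (Rbar_mult (/ Cmod (step_ratio x y))%R (Finite (0 + 0)))
    by (simpl; f_equal; ring).
  apply is_lim_seq_scal_l, is_lim_seq_plus'; assumption.
Qed.

(** * A bound on the sum that is uniform in [y] *)

(** With [a = Cmod x], the majorant is [(a+1)(a+2) / ((a+1+n)(a+2+n))], written as a difference so
    that it telescopes when summed. It equals 1 at [n = 0] and decreases no faster than the summand
    does. *)
Lemma t_term_le (x y : C) (n : nat) :
  (Cmod x + 3 <= Re (x + y))%R ->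
  (Cmod (t_term x y n) <= (Cmod x + 1) * (Cmod x + 2) *
     (/ (Cmod x + 1 + INR n) - / (Cmod x + 1 + INR (S n))))%R.
Proof.
intros Hs; pose proof (Cmod_ge_0 x) as Hx.
assert (Hp : forall k : nat, (Cmod x + 3 + INR k <= Cmod (x + y + INR k))%R).
{ intros k; eapply Rle_trans; [|apply Re_le_Cmod]; rewrite Re_add_INR; lra. }
assert (H : forall k : nat, x + y + INR k <> 0).
{ intros k; apply Cmod_gt_0; pose proof (Hp k); pose proof (pos_INR k); lra. }
induction n as [|n IH].
- specialize (H 0%nat); specialize (Hp 0%nat); simpl in H, Hp |- *.
  rewrite Cplus_0_r in H, Hp.
  rewrite t_term_0, Cmod_div by exact H.
  apply Rle_trans with 1%R; [apply Rle_div_l; lra|].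
  right; field; lra.
- rewrite t_term_succ by exact H.
  rewrite Cmod_mult, Cmod_opp, Cmod_div, !Cmod_mult.
  2:{ pose proof (H n); pose proof (H (S n)) as H1; rewrite RtoC_INR_S in H1.
      apply Cmult_neq_0; [assumption|solve_neq_0]. }
  pose proof (Hp n) as A; pose proof (Hp (S n)) as B.
  pose proof (pos_INR n) as P.
  assert (U : forall k : nat, (Cmod (x + INR k) <= Cmod x + INR k)%R).
  { intros k; eapply Rle_trans; [apply Cmod_triangle|].
    rewrite Cmod_R, Rabs_pos_eq by apply pos_INR; lra. }
  pose proof (U n) as A'; pose proof (U (S n)) as B'.
  rewrite RtoC_INR_S, Cplus_assoc in B, B'.
  rewrite !S_INR in *.
  pose proof (Cmod_ge_0 (x + INR n)); pose proof (Cmod_ge_0 (x + INR n + 1)).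
  set (a := Cmod x) in *; set (m := INR n) in *.
  (* The majorant's own term ratio is [(a + 1 + m) / (a + m + 3)]; it remains to compare the two
     ratios. *)
  replace ((a + 1) * (a + 2) * (/ (a + 1 + (m + 1)) - / (a + 1 + (m + 1 + 1))))%R
    with ((a + 1 + m) / (a + m + 3) *
          ((a + 1) * (a + 2) * (/ (a + 1 + m) - / (a + 1 + (m + 1)))))%R
    by (field; lra).
  apply Rmult_le_compat; [|apply Cmod_ge_0| |exact IH].
  + apply Rle_mult_inv_pos; [apply Rmult_le_pos; assumption|].
    apply Rmult_lt_0_compat; lra.
  (* The extra factor [a + m + 4] produces the denominator [(a+m+3)(a+m+4)], a lower bound for the
     product of the moduli of [x+y+m] and [x+y+m+1]. *)
  + replace ((a + 1 + m) / (a + m + 3))%R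
      with ((a + m + 1) * (a + m + 4) / ((a + m + 3) * (a + m + 4)))%R
      by (field; lra).
    apply Rle_trans with ((a + m) * (a + m + 1)
        / ((a + m + 3) * (a + m + 4)))%R.
    * apply Rmult_le_compat.
      -- apply Rmult_le_pos; assumption.
      -- apply Rlt_le, Rinv_0_lt_compat, Rmult_lt_0_compat; lra.
      -- apply Rmult_le_compat; lra.
      -- apply Rinv_le_contravar; [apply Rmult_lt_0_compat; lra|].
         apply Rmult_le_compat; lra.
    * apply Rmult_le_compat_r; [|nra].
      apply Rlt_le, Rinv_0_lt_compat, Rmult_lt_0_compat; lra.
Qed.

(** The telescoping majorant keeps every partial sum below [Cmod x + 2], and some partial sum lies
    within 1 of [l]. *)
Lemma Cmod_t_term_series_le (x y l : C) :
  (Cmod x + 3 <= Re (x + y))%R -> is_series (t_term x y) l ->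
  (Cmod l <= Cmod x + 3)%R.
Proof.
intros Hs Hl; pose proof (Cmod_ge_0 x) as Hx.
assert (S : forall n, (Cmod (sum_n (t_term x y) n) <= (Cmod x + 1) * (Cmod x + 2) *
     (/ (Cmod x + 1) - / (Cmod x + 1 + INR (S n))))%R).
{ intros n; induction n as [|n IH].
  - rewrite sum_O; pose proof (t_term_le x y 0 Hs) as T.
    change (INR 0) with 0%R in T; rewrite Rplus_0_r in T; exact T.
  - rewrite sum_Sn; pose proof (t_term_le x y (S n) Hs) as T.
    eapply Rle_trans; [apply Cmod_triangle|]; lra. }
apply is_series_Cmod in Hl; apply is_lim_seq_spec in Hl.
destruct (Hl (mkposreal 1 Rlt_0_1)) as [N HN].
specialize (HN N (le_n N)); simpl in HN; specialize (S N).
rewrite Rminus_0_r, Rabs_pos_eq in HN by apply Cmod_ge_0.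
replace l with (sum_n (t_term x y) N + - (sum_n (t_term x y) N - l)) by ring.
eapply Rle_trans; [apply Cmod_triangle|]; rewrite Cmod_opp.
assert (0 < / (Cmod x + 1 + INR (Datatypes.S N)))%R.
{ apply Rinv_0_lt_compat; pose proof (pos_INR (Datatypes.S N)); lra. }
assert ((Cmod x + 1) * (Cmod x + 2) * / (Cmod x + 1) = Cmod x + 2)%R by (field; lra).
assert (0 < (Cmod x + 1) * (Cmod x + 2))%R by nra.
nra.
Qed.

(** * Convergence excludes nonpositive integers [y] *)

Lemma Cdiv_neq_0 (z w : C) : z <> 0 -> w <> 0 -> z / w <> 0.
Proof.
intros Hz Hw E; apply Hz.
replace z with (z / w * w) by (field; exact Hw); rewrite E; ring.
Qed.

Lemma t_term_neq_0 (x y : C) (n : nat) :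
  (forall k : nat, x + y + INR k <> 0) -> (forall k : nat, x + INR k <> 0) ->
  t_term x y n <> 0.
Proof.
intros H Hx; unfold t_term.
replace (Z.of_nat n + 1)%Z with (Z.of_nat (S n)) by lia.
rewrite !poch_of_nat.
apply Cmult_neq_0.
- apply Cdiv_neq_0; apply Cmult_neq_0; apply rising_neq_0; assumption.
- intros E; apply (f_equal Cmod) in E.
  rewrite Cmod_pow, Cmod_m1, pow1, Cmod_0 in E; lra.
Qed.

Lemma Cmod_sub_R_le (z : C) (r : R) :
  (0 <= r <= Re z)%R -> (Cmod (z - r) <= Cmod z)%R.
Proof.
intros H; apply sqrt_le_1_alt; destruct z as [u v]; simpl in *; nra.
Qed.

(* When [y = -k], [|t_term x y n|] is eventually nondecreasing, as
   [|x + n - k| <= |x + n|] for large [n]. *)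
Lemma ex_series_t_term_neq (x y : C) (k : nat) :
  (forall n : nat, x + y + INR n <> 0) ->
  @ex_series C_AbsRing C_NormedModule (t_term x y) -> y + INR k <> 0.
Proof.
intros H Hex Hy.
assert (Ey : y = - INR k) by (replace y with (y + INR k - INR k) by ring; rewrite Hy; ring).
(* As [y = -k], a zero of [x + n] would be a zero of [x + y + (k + n)]. Hence no term vanishes, and
   the eventual lower bound on the moduli is positive. *)
assert (Hx : forall n : nat, x + INR n <> 0).
{ intros n E; apply (H (k + n)%nat).
  rewrite plus_INR, RtoC_plus, Ey, <- E; ring. }
destruct (eventually_Re_ge x (INR k)) as [N HN].
assert (L : forall n : nat,
  (Cmod (t_term x y N) <= Cmod (t_term x y (n + N)))%R).
{ intros n; induction n as [|n IH]; [apply Rle_refl|].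
  eapply Rle_trans; [exact IH|]; rewrite Nat.add_succ_l.
  set (m := (n + N)%nat).
  assert (Hm : (INR k <= Re x + INR m)%R) by (apply HN; unfold m; lia).
  pose proof (pos_INR k) as Pk.
  pose proof (H m) as A; pose proof (H (S m)) as B.
  rewrite RtoC_INR_S, Cplus_assoc in B.
  rewrite t_term_succ, Cmod_mult, Cmod_opp, Cmod_div, !Cmod_mult
    by first [exact H | now apply Cmult_neq_0].
  assert (A' : (Cmod (x + y + INR m) <= Cmod (x + INR m))%R).
  { replace (x + y + INR m) with (x + INR m - INR k) by (rewrite Ey; ring).
    apply Cmod_sub_R_le; rewrite Re_add_INR; lra. }
  assert (B' : (Cmod (x + y + INR m + 1) <= Cmod (x + INR m + 1))%R).
  { replace (x + y + INR m + 1) with (x + INR m + 1 - INR k) by (rewrite Ey; ring).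
    apply Cmod_sub_R_le; change (Re (x + INR m + 1)) with (Re x + INR m + 1)%R; lra. }
  apply Cmod_gt_0 in A; apply Cmod_gt_0 in B.
  rewrite <- (Rmult_1_l (Cmod (t_term x y m))) at 1.
  apply Rmult_le_compat_r; [apply Cmod_ge_0|].
  apply Rle_div_r; [now apply Rmult_lt_0_compat|].
  rewrite Rmult_1_l; apply Rmult_le_compat; lra. }
pose proof (proj1 (Cmod_gt_0 _) (t_term_neq_0 x y N H Hx)) as P.
apply ex_series_Cmod_lim, is_lim_seq_spec in Hex.
destruct (Hex (mkposreal _ P)) as [M HM].
specialize (HM (M + N)%nat ltac:(lia)); specialize (L M); simpl in HM.
rewrite Rminus_0_r, Rabs_pos_eq in HM by apply Cmod_ge_0; lra.
Qed.

Lemma step_ratio_neq_0 (x y : C) :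
  (forall n : nat, x + y + INR n <> 0) -> (forall k : nat, y + INR k <> 0) ->
  step_ratio x y <> 0.
Proof.
intros H Hy; unfold step_ratio.
pose proof (H 0%nat) as A0; pose proof (H 1%nat) as A1.
pose proof (Hy 0%nat) as B0; pose proof (Hy 1%nat) as B1; pose proof (Hy 2%nat) as B2.
rewrite !RtoC_INR_S in *; simpl INR in *.
replace (x + y + 0) with (x + y) in A0 by ring.
replace (x + y + (0 + 1)) with (x + y + 1) in A1 by ring.
replace (y + 0) with y in B0 by ring.
replace (y + (0 + 1)) with (y + 1) in B1 by ring.
replace (y + (0 + 1 + 1)) with (y + 2) in B2 by ring.
replace (- (1 / 4)) with (RtoC (- (1 / 4)))
  by (rewrite RtoC_opp, RtoC_div by lra; reflexivity).
apply Cmult_neq_0; [intros E; apply RtoC_inj in E; lra|].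
apply Cdiv_neq_0; repeat apply Cmult_neq_0; trivial;
  intros E; apply RtoC_inj in E; lra.
Qed.

(** * Iteration of the recurrence *)

Fixpoint ratio_prod (x y : C) (n : nat) : C :=
  match n with
  | O => 1
  | S k => ratio_prod x y k * step_ratio x (y + 2 * INR k)
  end.

Lemma shift_poles_iter (x y : C) (j : nat) :
  (forall n : nat, x + y + INR n <> 0) ->
  forall n : nat, x + (y + 2 * INR j) + INR n <> 0.
Proof.
intros H n E; apply (H (j + j + n)%nat); rewrite !plus_INR, !RtoC_plus, <- E; ring.
Qed.

(** Each step needs a nonzero [step_ratio] at [y + 2j]; this follows from the convergence at
    [y + 2j] supplied by the previous step. *)
Lemma ex_series_t_term_iter (x y : C) (j : nat) :
  (forall n : nat, x + y + INR n <> 0) ->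
  @ex_series C_AbsRing C_NormedModule (t_term x y) ->
  @ex_series C_AbsRing C_NormedModule (t_term x (y + 2 * INR j)).
Proof.
intros H Hex; induction j as [|j [l Hl]].
- now replace (y + 2 * INR 0) with y by (simpl; ring).
- replace (y + 2 * INR (S j)) with (y + 2 * INR j + 2)
    by (rewrite RtoC_INR_S; ring).
  pose proof (shift_poles_iter x y j H) as Hj.
  eexists; apply is_series_t_term_shift; [exact Hj| |exact Hl].
  apply step_ratio_neq_0; [exact Hj|].
  intros k; apply (ex_series_t_term_neq x); [exact Hj|now exists l].
Qed.

Lemma t_correct (x y : C) :
  @ex_series C_AbsRing C_NormedModule (t_term x y) -> is_series (t_term x y) (t x y).
Proof.
intros [l Hl]; unfold t; now rewrite (CSeries_unique _ _ Hl).
Qed.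

(** The quotient [x / (x + y)] is the summand at [n = 0]. *)
Lemma t_recurrence (x y : C) :
  (forall n : nat, x + y + INR n <> 0) ->
  @ex_series C_AbsRing C_NormedModule (t_term x y) ->
  t x y = cert y x * (x / (x + y)) + step_ratio x y * t x (y + 2).
Proof.
intros H Hex; pose proof (t_correct _ _ Hex) as Hl.
assert (HB : step_ratio x y <> 0).
{ apply step_ratio_neq_0; [exact H|].
  intros k; exact (ex_series_t_term_neq x y k H Hex). }
apply (is_series_t_term_shift x y _ H HB), CSeries_unique in Hl.
pose proof (H 0%nat) as H0; simpl in H0.
rewrite t_term_0 in Hl by solve_neq_0.
unfold t at 2; rewrite Hl; field; solve_neq_0.
Qed.

(** * Closed form of the product, and the accelerated terms *)

Lemma half_add_INR_neq_0 (z : C) :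
  (forall k : nat, z + INR k <> 0) -> forall k : nat, z / 2 + INR k <> 0.
Proof.
intros H k E; apply (H (k + k)%nat).
rewrite plus_INR, RtoC_plus.
replace (z + (INR k + INR k)) with (2 * (z / 2 + INR k)) by (field; solve_neq_0).
rewrite E; ring.
Qed.

(** Each linear factor of [step_ratio] at [y + 2k] is twice a factor of the form [c + k]. There are
    four above and four below, so the powers of 2 cancel. *)
Lemma ratio_prod_closed (x y : C) (n : nat) :
  (forall k : nat, x + y + INR k <> 0) ->
  ratio_prod x y n =
  (- (1 / 4)) ^ n
  * (rising (y / 2) n * rising (y / 2) n * rising (y / 2 + 1) n * rising ((y + 1) / 2) n
     / (rising ((x + y) / 2) n * rising ((x + y) / 2) n
        * rising ((x + y + 1) / 2) n * rising ((x + y + 1) / 2) n)).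
Proof.
intros H.
assert (HA : forall k : nat, (x + y) / 2 + INR k <> 0) by (apply half_add_INR_neq_0, H).
assert (HB : forall k : nat, (x + y + 1) / 2 + INR k <> 0).
{ apply half_add_INR_neq_0; intros k; pose proof (H (S k)) as HS.
  rewrite RtoC_INR_S in HS; solve_neq_0. }
induction n as [|n IH].
- simpl; field; solve_neq_0.
- simpl ratio_prod; rewrite IH.
  pose proof (rising_neq_0 _ n HA) as A0; pose proof (rising_neq_0 _ n HB) as B0.
  specialize (HA n); specialize (HB n).
  pose proof (shift_poles_iter x y n H) as Hn.
  pose proof (Hn 0%nat) as C0; pose proof (Hn 1%nat) as C1.
  rewrite RtoC_INR_S in C1; simpl in C0, C1.
  change (rising ?a (S n)) with (rising a n * (a + INR n)).
  change (?a ^ S n) with (a * a ^ n).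
  unfold step_ratio; set (p := (- (1 / 4)) ^ n).
  generalize dependent (rising ((x + y) / 2) n); intros ra ? ?.
  generalize dependent (rising ((x + y + 1) / 2) n); intros rb ? ?.
  field; solve_neq_0.
Qed.

(** Lowering each bracket parameter by one turns index [j - 1] into [j] at the cost of a division by
    the new parameter. These divisors cancel [y^2 (y+1) (y+2)] and [(x+y)^2 (x+y+1)^2] in the
    prefactor; what is left is [cert] at [u = x] times the summand at 0. *)
Lemma accel_term_ratio (x y : C) (j : nat) :
  (forall k : nat, x + y + INR k <> 0) -> (forall k : nat, y + INR k <> 0) ->
  accel_term x y j =
  ratio_prod x y j
  * (cert (y + 2 * INR j) x * (x / (x + (y + 2 * INR j)))).
Proof.
intros H Hy; rewrite ratio_prod_closed by exact H.
unfold accel_term, poch_bracket, poch_prod; simpl List.fold_right.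
pose proof (H 0%nat) as A0; pose proof (H 1%nat) as A1.
pose proof (Hy 0%nat) as B0; pose proof (Hy 1%nat) as B1; pose proof (Hy 2%nat) as B2.
rewrite !RtoC_INR_S in *; simpl INR in *.
assert (half : forall z : C, z <> 0 -> z / 2 <> 0)
  by (intros z Hz; apply Cdiv_neq_0; [exact Hz|solve_neq_0]).
assert (C0 : y / 2 <> 0) by (apply half; solve_neq_0).
assert (C1 : (y + 1) / 2 <> 0) by (apply half; solve_neq_0).
assert (C2 : y / 2 + 1 <> 0).
{ replace (y / 2 + 1) with ((y + 2) / 2) by (field; solve_neq_0).
  apply half; solve_neq_0. }
assert (D0 : (x + y) / 2 <> 0) by (apply half; solve_neq_0).
assert (D1 : (x + y + 1) / 2 <> 0) by (apply half; solve_neq_0).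
replace (y / 2 + 2) with (y / 2 + 1 + 1) by ring.
replace ((y + 3) / 2) with ((y + 1) / 2 + 1) by (field; solve_neq_0).
replace ((x + y + 3) / 2) with ((x + y + 1) / 2 + 1) by (field; solve_neq_0).
rewrite !poch_pred by assumption.
assert (HA : forall k : nat, (x + y) / 2 + INR k <> 0) by (apply half_add_INR_neq_0, H).
assert (HB : forall k : nat, (x + y + 1) / 2 + INR k <> 0).
{ apply half_add_INR_neq_0; intros k; pose proof (H (S k)) as HS.
  rewrite RtoC_INR_S in HS; solve_neq_0. }
pose proof (rising_neq_0 _ j HA) as E0; pose proof (rising_neq_0 _ j HB) as E1.
pose proof (shift_poles_iter x y j H 0) as F0.
pose proof (shift_poles_iter x y j H 1) as F1.
rewrite !RtoC_INR_S in *; simpl INR in *.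
unfold cert; set (p := (- (1 / 4)) ^ j).
generalize dependent (rising ((x + y) / 2) j); intros ra ?.
generalize dependent (rising ((x + y + 1) / 2) j); intros rb ?.
generalize (rising (y / 2) j) (rising (y / 2 + 1) j) (rising ((y + 1) / 2) j).
intros r0 r1 r2; clear H Hy HA HB half.
field; solve_neq_0.
Qed.

(** The recurrence unrolled along [y + 2j]. As [sum_n] includes the index [n], the remainder carries
    [S n] factors. *)
Lemma sum_accel_term (x y : C) (n : nat) :
  (forall k : nat, x + y + INR k <> 0) ->
  @ex_series C_AbsRing C_NormedModule (t_term x y) ->
  t x y - sum_n (accel_term x y) n
  = ratio_prod x y (S n) * t x (y + 2 * INR (S n)).
Proof.
intros H Hex.
assert (Hy : forall k : nat, y + INR k <> 0)
  by (intros k; exact (ex_series_t_term_neq x y k H Hex)).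
assert (R : forall j : nat, t x (y + 2 * INR j) =
  cert (y + 2 * INR j) x * (x / (x + (y + 2 * INR j)))
  + step_ratio x (y + 2 * INR j) * t x (y + 2 * INR (S j))).
{ intros j; rewrite t_recurrence.
  - do 3 f_equal; rewrite RtoC_INR_S; ring.
  - apply shift_poles_iter, H.
  - apply ex_series_t_term_iter; assumption. }
induction n as [|n IH].
- rewrite sum_O, accel_term_ratio by assumption.
  replace (t x y) with (t x (y + 2 * INR 0)) by (f_equal; simpl; ring).
  rewrite R; cbn [ratio_prod]; ring.
- rewrite sum_Sn, accel_term_ratio by assumption; change plus with Cplus.
  replace (t x y) with (t x y - sum_n (accel_term x y) n + sum_n (accel_term x y) n)
    by ring.
  rewrite IH, (R (S n)); change (ratio_prod x y (S (S n))) with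
    (ratio_prod x y (S n) * step_ratio x (y + 2 * INR (S n))); ring.
Qed.

(** * Decay of the remainder *)

(** The hypotheses make [Cmod x + 1] at most a quarter of [Cmod (x + y)] and of [Cmod (x + y + 1)],
    so each numerator factor is at most [5/4] of the denominator factor paired with it. *)
Lemma Cmod_step_ratio_le (x y : C) :
  (4 * (Cmod x + 1) <= Cmod (x + y))%R -> (4 * (Cmod x + 1) <= Cmod (x + y + 1))%R ->
  (Cmod (step_ratio x y) <= 5 / 8)%R.
Proof.
intros H1 H2; pose proof (Cmod_ge_0 x) as Px.
assert (B0 : (Cmod y <= 5 / 4 * Cmod (x + y))%R).
{ replace y with (x + y + - x) at 1 by ring.
  eapply Rle_trans; [apply Cmod_triangle|]; rewrite Cmod_opp; lra. }
assert (B1 : (Cmod (y + 1) <= 5 / 4 * Cmod (x + y + 1))%R).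
{ replace (y + 1) with (x + y + 1 + - x) at 1 by ring.
  eapply Rle_trans; [apply Cmod_triangle|]; rewrite Cmod_opp; lra. }
assert (B2 : (Cmod (y + 2) <= 5 / 4 * Cmod (x + y + 1))%R).
{ replace (y + 2) with (x + y + 1 + (- x + 1)) at 1 by ring.
  eapply Rle_trans; [apply Cmod_triangle|].
  pose proof (Cmod_triangle (- x) 1) as T; rewrite Cmod_opp, Cmod_1 in T; lra. }
unfold step_ratio.
assert (N : (x + y) ^ 2 * (x + y + 1) ^ 2 <> 0)
  by (repeat apply Cmult_neq_0; try apply Cmod_gt_0; try rewrite Cmod_1; lra).
rewrite Cmod_mult, Cmod_opp, !Cmod_div
  by first [ exact N | intros E; apply RtoC_inj in E; lra ].
rewrite !Cmod_mult, !Cmod_pow, !Cmod_R.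
rewrite !Rabs_pos_eq by lra.
pose proof (Cmod_ge_0 y); pose proof (Cmod_ge_0 (y + 1)); pose proof (Cmod_ge_0 (y + 2)).
set (a := Cmod (x + y)) in *; set (b := Cmod (x + y + 1)) in *.
assert (0 < a ^ 2 * b ^ 2)%R by (apply Rmult_lt_0_compat; apply pow_lt; lra).
assert (E : (Cmod y ^ 2 * Cmod (y + 1) * Cmod (y + 2)
  <= (5 / 4 * a) ^ 2 * (5 / 4 * b) * (5 / 4 * b))%R).
{ assert (0 <= Cmod y ^ 2)%R by (apply pow_le; lra).
  apply Rmult_le_compat; trivial; [nra|].
  apply Rmult_le_compat; trivial; apply pow_incr; lra. }
(* The four factors [5/4] and the leading [1/4] give [625/1024], just below [5/8 = 640/1024]. *)
apply Rle_trans with (1 / 4 * (((5 / 4 * a) ^ 2 * (5 / 4 * b) * (5 / 4 * b)) / (a ^ 2 * b ^ 2)))%R.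
- apply Rmult_le_compat_l; [lra|]; apply Rmult_le_compat_r; [|exact E].
  now apply Rlt_le, Rinv_0_lt_compat.
- replace (1 / 4 * ((5 / 4 * a) ^ 2 * (5 / 4 * b) * (5 / 4 * b) / (a ^ 2 * b ^ 2)))%R
    with (625 / 1024)%R by (field; lra).
  lra.
Qed.

Lemma ratio_prod_lim (x y : C) : is_lim_seq (fun n => Cmod (ratio_prod x y n)) 0.
Proof.
(* From [N] on, every factor has modulus at most [5/8], so the product decays geometrically. *)
destruct (eventually_Re_ge (x + y) (4 * (Cmod x + 1))) as [N HN].
apply (is_lim_seq_incr_n _ N).
apply (is_lim_seq_0_le _ (fun n => Cmod (ratio_prod x y N) * (5 / 8) ^ n)%R).
- exists 0%nat; intros n _; split; [apply Cmod_ge_0|].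
  induction n as [|n IH]; [simpl; lra|].
  rewrite Nat.add_succ_l; simpl ratio_prod; rewrite Cmod_mult; simpl pow.
  replace (Cmod (ratio_prod x y N) * (5 / 8 * (5 / 8) ^ n))%R
    with (Cmod (ratio_prod x y N) * (5 / 8) ^ n * (5 / 8))%R by ring.
  apply Rmult_le_compat; try apply Cmod_ge_0; [exact IH|].
  pose proof (HN (n + N)%nat ltac:(lia)) as Hn; pose proof (pos_INR (n + N)) as P.
  apply Cmod_step_ratio_le; (eapply Rle_trans; [|apply Re_le_Cmod]);
    simpl in *; lra.
- replace (Finite 0) with (Rbar_mult (Cmod (ratio_prod x y N)) 0)
    by (simpl; f_equal; ring).
  apply is_lim_seq_scal_l, is_lim_seq_geom; rewrite Rabs_pos_eq; lra.
Qed.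

Theorem theorem5 (x y : C)
  (* no denominator (x+y)_n vanishes *)
  (hpole : forall n : nat, x + y + INR n <> 0)
  (hleft : ex_series (t_term x y))
  (hright : ex_series (accel_term x y)) :
  t x y = CSeries (accel_term x y).
Proof.
symmetry; apply CSeries_unique, is_series_Cmod.
apply (is_lim_seq_0_le _
  (fun n => ((Cmod x + 3) * Cmod (ratio_prod x y (S n)))%R)).
(* The uniform bound on [t] applies once the real part of [x + y + 2(n+1)] reaches [Cmod x + 3], so
   the estimate is only eventual. *)
- generalize (eventually_Re_ge (x + y) (Cmod x + 3)); apply filter_imp.
  intros n Hn; split; [apply Cmod_ge_0|].
  rewrite <- Cmod_opp.
  replace (- (sum_n (accel_term x y) n - t x y))
    with (t x y - sum_n (accel_term x y) n) by ring.
  rewrite sum_accel_term, Cmod_mult, Rmult_comm by assumption.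
  apply Rmult_le_compat_r; [apply Cmod_ge_0|].
  apply (Cmod_t_term_series_le x (y + 2 * INR (S n))).
  + pose proof (pos_INR n); rewrite S_INR; simpl in *; lra.
  + apply t_correct, ex_series_t_term_iter; assumption.
- replace (Finite 0) with (Rbar_mult (Cmod x + 3)%R 0) by (simpl; f_equal; ring).
  apply is_lim_seq_scal_l.
  apply (is_lim_seq_incr_1 (fun n => Cmod (ratio_prod x y n))), ratio_prod_lim.
Qed.
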